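(* Let $t$ be a nonnegative integer. For every graph $G$ of treewidth at most $t$, every $A\subseteq V(G)$, and every nonnegative integer $r$, $$|\Pi_{r,G}[V(G)\to A]|\le (t+1)(r+2)^t\binom{r+t}{t}|A| .$$ In particular $|\Pi_{r,G}[V(G)\to A]| = O_t(r^{2t}|A|)$, i.e. there is a constant $C_t$ depending only on $t$ such that $|\Pi_{r,G}[V(G)\to A]|\le C_t\, r^{2t}|A|$ for all such $G$, $A$ and all $r\ge 1$.
   Context: All graphs are finite, simple and undirected. For a graph $G$, $A\subseteq V(G)$, $u\in V(G)$ and an integer $r\ge 0$, the profile $\pi_{r,G}[u\to A]$ is the function $A\to\{0,\dots,r,+\infty\}$ mapping $a\in A$ to $\mathrm{dist}_G(u,a)$ if $\mathrm{dist}_G(u,a)\le r$, and to $+\infty$ otherwise. For $U\subseteq V(G)$, $\Pi_{r,G}[U\to A]$ is the set of all profiles $\pi_{r,G}[u\to A]$ for $u\in U$, excluding the profile that is constantly $+\infty$. *)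

(* Defs.v *)
From HB Require Import structures.
From mathcomp Require Import all_boot.

Set Implicit Arguments.
Unset Strict Implicit.
Unset Printing Implicit Defensive.

Record sgraph := SGraph {
  vertex :> finType;
  adj : rel vertex;
  adj_sym : symmetric adj;
  adj_irr : irreflexive adj
}.

Arguments adj {s} _ _.

Definition walk (G : sgraph) (u v : G) (k : nat) : bool :=
  [exists p : k.-tuple G, path adj u p && (last u p == v)].

Lemma connect_walk (G : sgraph) (u v : G) :
  connect adj u v -> exists k, walk u v k.
Proof.
case/connectP=> p pth ->; exists (size p).
by apply/existsP; exists (in_tuple p); rewrite pth eqxx.
Qed.

(* Length of a shortest walk; [None] stands for +oo. *)
Definition dist (G : sgraph) (u v : G) : option nat :=
  if @idP (connect adj u v) is ReflectT uv then Some (ex_minn (connect_walk uv))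
  else None.

(* The range {0, ..., r, +oo} is [option 'I_r.+1], with [None] for +oo;
   [insub] sends d to [Some d] if d <= r and to [None] otherwise. *)
Definition profile (G : sgraph) (r : nat) (A : {set G}) (u : G) :
    {ffun {a : G | a \in A} -> option 'I_r.+1} :=
  [ffun a => if dist u (val a) is Some d then insub d else None].

Definition profiles (G : sgraph) (r : nat) (U A : {set G}) :
    {set {ffun {a : G | a \in A} -> option 'I_r.+1}} :=
  [set profile r A u | u in U] :\ [ffun=> None].

Definition connected_in (G : sgraph) (S : {set G}) : Prop :=
  {in S &, forall x y,
    connect [rel x' y' | [&& x' \in S, y' \in S & adj x' y']] x y}.

(* An edge traversed back and forth is a [ucycle] of size 2, and the empty
   sequence is one of size 0; genuine cycles have size at least 3. *)
Definition is_tree (G : sgraph) : Prop :=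
  [/\ 0 < #|G|,
      connected_in [set: G] &
      forall c : seq G, ucycle adj c -> size c < 3].

Record tree_decomposition (G T : sgraph) (bag : T -> {set G}) : Prop :=
  TreeDecomposition {
    td_tree : is_tree T;
    td_vertex : forall v : G, exists x : T, v \in bag x;
    td_edge : forall u v : G, adj u v ->
      exists x : T, (u \in bag x) && (v \in bag x);
    td_connected : forall v : G, connected_in [set x : T | v \in bag x]
  }.

(* The predecessor is truncated: a decomposition with only empty bags (possible
   only for the graph without vertices) gets width 0 instead of -1. This does
   not affect upper bounds by a natural number. *)
Definition width (G T : sgraph) (bag : T -> {set G}) : nat :=
  (\max_(x : T) #|bag x|).-1.

Definition treewidth_le (G : sgraph) (t : nat) : Prop :=
  exists (T : sgraph) (bag : T -> {set G}),
    tree_decomposition bag /\ width bag <= t.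

(* Main.v *)
Require Import Defs.
From HB Require Import structures.
From mathcomp Require Import all_boot.

Set Implicit Arguments.
Unset Strict Implicit.
Unset Printing Implicit Defensive.

(** A tree decomposition of width [t], once its tree is rooted, orders the
    vertices of the graph so that every vertex [v] has a set [back v] of at most
    [t] smaller vertices, its back neighbours; any two elements of [back v] are
    joined by a back arc, and so are the ends of every edge. This is the perfect
    elimination order of a chordal completion
    ([treewidth_elimination_order]). Call [v] an ancestor of [u] when back arcs
    lead from [u] to [v]; the ancestors of a vertex form a chain.

    The hubs are the vertices at most [r] back arcs away from some vertex of
    [A]. There are at most ['C(r + t, t)] of them for each element of [A]
    ([card_reach]). The smallest vertex of any walk of length at most [r] from
    [u] to [A] is both a hub and an ancestor of [u] ([walk_min]).

    Attach to each vertex [u] within distance [r] of [A] its largest hub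
    ancestor [v]. If [u != v], let [w] be the smallest ancestor of [u] above [v]. A short
    walk from [u] to [A] reaches a vertex not larger than [v], hence leaves the
    set of vertices that have [w] as an ancestor, and this is only possible
    through [back w] ([cross_back]). So [back w] meets all those walks, and the
    profile of [u] on [A] is determined by its profile on [back w]
    ([guarded_profile]), for which there are at most [(r + 2) ^ t] values.
    Moreover [back w] contains [v] and is contained in [v |: back v]
    ([hub_guard]), a set of at most [t + 1] vertices; it therefore lies in one
    of the [t] sets obtained by deleting a vertex of [back v], unless that set
    is already small enough to serve as a whole. With one more profile for
    [u = v], each hub accounts for at most [1 + t * (r + 2) ^ t] profiles, which
    is at most [(t + 1) * (r + 2) ^ t] ([card_hub_class_profiles]). *)

(** * Walks and profiles *)

Definition within (G : sgraph) (k : nat) (u v : G) : Prop :=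
  exists p, [/\ path adj u p, last u p = v & size p <= k].

Lemma distP (G : sgraph) (u v : G) k :
  within k u v <-> exists2 d, dist u v = Some d & d <= k.
Proof.
have walkI p : path adj u p -> last u p = v -> walk u v (size p).
  by move=> pp lp; apply/existsP; exists (in_tuple p); rewrite pp lp eqxx.
rewrite /dist; case: {-}_ / idP => [uv | nuv]; last first.
  split=> [[p [pp lp _]] | [? //]].
  by case: nuv; apply/connectP; exists p.
case: ex_minnP => m wm mmin; split=> [[p [pp lp sp]] | [_ [<-] mk]].
  by exists m => //; apply: leq_trans sp; apply/mmin/walkI.
case/existsP: wm => p /andP[pp /eqP lp].
by exists p; rewrite size_tuple.
Qed.

(** Truncating distances at [r] forgets exactly the thresholds above [r]; in
    terms of thresholds, profiles can be compared by cutting and pasting walks,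
    with no shortest walk to choose. *)
Lemma profile_eq (G : sgraph) r (A : {set G}) u u' :
  (profile r A u = profile r A u') <->
  (forall a k, a \in A -> k <= r -> within k u a <-> within k u' a).
Proof.
have trunc (x : G) a k : k <= r -> within k x a <->
    exists2 i : 'I_r.+1,
      (if dist x a is Some d then insub d else None) = Some i & i <= k.
  move=> kr; apply: (iff_trans (distP _ _ _)); split=> [[d -> dk] | [i]].
    have dr : d < r.+1 by rewrite ltnS (leq_trans dk).
    by exists (Ordinal dr); rewrite ?insubT.
  case: (dist x a) => // d; case: insubP => // j _ <- [<-] jk.
  by exists (val j).
split=> [/ffunP eqp a k aA kr | eqw].
  have := eqp (Sub a aA); rewrite !ffunE /= => eqd.
  apply: (iff_trans (trunc _ _ _ kr)); rewrite eqd.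
  exact: iff_sym (trunc _ _ _ kr).
apply/ffunP=> [[a aA]]; rewrite !ffunE /=.
have step (x y : G) : (forall k, k <= r -> within k x a -> within k y a) ->
  forall i : 'I_r.+1,
  (if dist x a is Some d then insub d else None) = Some i ->
  exists2 j : 'I_r.+1,
  (if dist y a is Some d then insub d else None) = Some j & j <= i.
  move=> xy i ei; apply/trunc; first by rewrite -ltnS.
  by apply: xy; [rewrite -ltnS | apply/trunc; [rewrite -ltnS | exists i]].
have uu' := step u u' (fun k kr => proj1 (eqw a k aA kr)).
have u'u := step u' u (fun k kr => proj2 (eqw a k aA kr)).
move: uu' u'u; set f := if _ is Some _ then _ else _.
set g := if _ is Some _ then _ else _.
case: f => [i|]; case: g => [j|] // fg gf.
- have [_ [<-] ji] := fg i erefl; have [_ [<-] ij] := gf j erefl.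
  by congr Some; apply/val_inj/eqP; rewrite eqn_leq ij ji.
- by have [] := fg i erefl.
- by have [] := gf j erefl.
Qed.

Lemma profile_neq_infty (G : sgraph) r (A : {set G}) u :
  profile r A u != [ffun=> None] -> exists2 a, a \in A & within r u a.
Proof.
move/eqP=> neq; suff /existsP[[a aA]] : [exists a, profile r A u a != None].
  rewrite ffunE /=; case ed: (dist u a) => [d|//].
  case: insubP => // i dr _ _; exists a => //.
  by apply/distP; exists d => //; rewrite -ltnS.
apply: contra_notT neq; rewrite negb_exists => /forallP none.
by apply/ffunP=> a; rewrite [RHS]ffunE; apply/eqP; rewrite -[_ == _]negbK.
Qed.

Definition guards (G : sgraph) r (A S : {set G}) u : Prop :=
  forall p, path adj u p -> last u p \in A -> size p <= r ->
  exists2 s, s \in S & s \in u :: p.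

(** A short walk from [u] to [A] can be cut at a guard, and its first part
    replaced by an equally short walk from [u'] to the same guard. *)
Lemma guarded_profile (G : sgraph) r (A S : {set G}) u u' :
  guards r A S u -> guards r A S u' ->
  profile r S u = profile r S u' -> profile r A u = profile r A u'.
Proof.
move=> gu gu' /profile_eq eqS; apply/profile_eq => a k aA kr.
have half (x y : G) : guards r A S x ->
  (forall s l, s \in S -> l <= r -> within l x s -> within l y s) ->
  within k x a -> within k y a.
  move=> gx xy [p [pp lp sp]].
  have [|| s sS] := gx p pp; rewrite ?lp ?(leq_trans sp) //.
  move=> sp'; case/splitPl: sp' pp lp sp => p1 p2 lp1.
  rewrite cat_path last_cat size_cat lp1 => /andP[pp1 pp2] lp2 sp.
  have [||q [pq lq sq]] := xy s (size p1) sS.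
  - exact: leq_trans (leq_addr _ _) (leq_trans sp kr).
  - by exists p1.
  exists (q ++ p2); rewrite cat_path last_cat size_cat pq lq; split=> //.
  by apply: leq_trans sp; rewrite leq_add2r.
by split; apply: half => // s l sS lr; case: (eqS s l sS lr).
Qed.

Lemma leq_card_imset_factor (aT rT sT : finType) (f : aT -> rT) (g : aT -> sT)
    (B : {set aT}) :
  {in B &, forall x y, g x = g y -> f x = f y} -> #|f @: B| <= #|g @: B|.
Proof.
move=> fg; have [->|[b0 b0B]] := set_0Vmem B; first by rewrite !imset0 cards0.
pose h z := if [pick x in B | g x == z] is Some x then f x else f b0.
suff -> : f @: B = h @: (g @: B) by apply: leq_imset_card.
rewrite -imset_comp; apply: eq_in_imset => x xB /=; rewrite /h.
case: pickP => [y /andP[yB /eqP gyx]|/(_ x)]; first exact: fg.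
by rewrite xB eqxx.
Qed.

Lemma card_guarded_profiles (G : sgraph) r (A S B : {set G}) :
  (forall u, u \in B -> guards r A S u) ->
  #|profile r A @: B| <= (r + 2) ^ #|S|.
Proof.
move=> gB; apply: (@leq_trans #|profile r S @: B|).
  by apply: leq_card_imset_factor => u u' /gB gu /gB; apply: guarded_profile.
apply: leq_trans (max_card _) _.
by rewrite card_ffun card_option card_ord card_sig addn2.
Qed.

(** * Rooting a tree *)

(** The depth is the distance to an arbitrary root and the parent is a neighbour
    nearer to the root. An edge [xy] that joins no vertex to its parent is
    bypassed by the two chains of parents from [x] and [y] to the root, so it
    closes a cycle. The root is its own parent. *)
Lemma tree_root (T : sgraph) : is_tree T ->
  exists (depth : T -> nat) (par : T -> T),
    (forall x, par x != x -> depth (par x) < depth x) /\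
    (forall x y, adj x y -> x = par y \/ y = par x).
Proof.
case=> /card_gt0P[root _] conn acyc.
pose depth (x : T) := odflt 0 (dist x root).
have conn_root (x : T) : connect adj x root.
  apply: (connect_sub _ (conn x root (in_setT _) (in_setT _))) => y z /=.
  by rewrite !inE /=; apply: connect1.
have up (x : T) : x != root -> exists2 y, adj x y & depth y < depth x.
  move=> xroot; have /connectP[p pp lp] := conn_root x.
  have [|d dx _] := (distP x root (size p)).1; first by exists p.
  have [|[|y q] [/= pq lq sq]] := (distP x root d).2; first by exists d.
    by rewrite lq eqxx in xroot.
  case/andP: pq => xy pq; exists y => //.
  have [|e dy eq] := (distP y root (size q)).1; first by exists q.
  by rewrite /depth dx dy /= (leq_ltn_trans eq).
pose par x := if [pick y | adj x y && (depth y < depth x)] is Some y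
  then y else x.
have parP x : x != root -> adj x (par x) && (depth (par x) < depth x).
  case/up=> y xy yx; rewrite /par; case: pickP => [//|/(_ y)].
  by rewrite xy yx.
exists depth, par; split=> [x | x y xy].
  by rewrite /par; case: pickP => [y /andP[]|]; rewrite ?eqxx.
have [->|xpar] := eqVneq x (par y); [by left | right].
apply/eqP; rewrite -[_ == _]negbK; apply/negP => ypar.
(* The tree without the edge [xy]. *)
pose e : rel T := [rel u v | adj u v &&
  ~~ ((u == x) && (v == y) || (u == y) && (v == x))].
have e_sym : connect_sym e.
  apply: sym_connect_sym => u v; rewrite /e /= adj_sym orbC.
  by rewrite [(u == y) && _]andbC [(u == x) && _]andbC.
have e_root n : forall z, depth z <= n -> connect e z root.
  elim: n => [|n IHn] z zn; have [->//|zroot] := eqVneq z root.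
    by have /andP[_ pz] := parP z zroot; have := leq_trans pz zn.
  have /andP[zp pz] := parP z zroot.
  apply: connect_trans (IHn _ (leq_trans pz zn)).
  apply: connect1; rewrite /e /= zp /=; apply/norP; split; apply/andP.
    by case=> /eqP-> /eqP yp; rewrite yp eqxx in ypar.
  by case=> /eqP-> /eqP xp; rewrite xp eqxx in xpar.
have : connect e x y.
  by rewrite (connect_trans (e_root _ x (leqnn _))) // e_sym; apply: e_root.
case/connectP=> p pp ly.
case/shortenP: pp ly => {}p pp up_ _ ly.
have pe : path adj x p by apply: sub_path pp => u v /andP[].
have : size (x :: p) < 3.
  apply: acyc; rewrite /ucycle (_ : cycle _ _ = true) //=.
  by rewrite rcons_path pe -ly adj_sym.
case: p pp ly {pe up_} => [|z [|//]] /=.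
  by move=> _ yx; rewrite yx adj_irr in xy.
by rewrite andbT => + yz; rewrite -yz /e /= !eqxx andbF.
Qed.

(** * Elimination orders *)

(** The digraph of back arcs encodes a chordal supergraph together with a
    perfect elimination order. The order is given by an injection into the
    natural numbers, so that extrema can be taken with [arg_minnP] and
    [arg_maxnP]. *)
Record elimination_order (G : sgraph) (t : nat)
    (pos : G -> nat) (back : G -> {set G}) : Prop := EliminationOrder {
  pos_inj : injective pos;
  pos_back : forall v w, w \in back v -> pos w < pos v;
  card_back : forall v, #|back v| <= t;
  back_adj : forall u v, adj u v -> u \in back v \/ v \in back u;
  back_clique : forall v w w',
    w \in back v -> w' \in back v -> pos w < pos w' -> w \in back w'
}.

(** A subtree is closed under parents except at its top [x]: a path inside [S]
    from [y] to [x] has to leave the set of descendants of [y], and the only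
    edge that leaves this set joins [y] to its parent. *)
Lemma connected_up (T : sgraph) (depth : T -> nat) (par : T -> T) :
  (forall x, par x != x -> depth (par x) < depth x) ->
  (forall x y, adj x y -> x = par y \/ y = par x) ->
  forall (S : {set T}) x y, connected_in S -> x \in S -> y \in S ->
  depth x <= depth y -> x != y -> (par y \in S) && (par y != y).
Proof.
move=> par_lt par_adj S x y conn xS yS xy neq.
have below_depth z : fconnect par z y -> z != y -> depth y < depth z.
  move/iter_findex; move: (findex _ _ _) => n.
  elim: n z => [|n IHn] z; rewrite ?iterSr /=; first by move=> ->; rewrite eqxx.
  move=> zy zny; have [pz|pz] := eqVneq (par z) z.
    by rewrite pz in zy; apply: IHn.
  have [<-|pzy] := eqVneq (par z) y; first exact: par_lt.
  exact: ltn_trans (IHn _ zy pzy) (par_lt z pz).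
have x_out : ~~ fconnect par x y.
  by apply/negP => /below_depth/(_ neq); rewrite ltnNge xy.
have /connectP[p pp lp] := conn y x yS xS.
have : fconnect par y y by [].
elim: p {1 2 3}y pp lp => [|z' p IHp] z /=.
  by move=> _ xz zy; rewrite xz zy in x_out.
case/andP=> /and3P[zS z'S zz'] pp lp zy.
have [z'y|z'y] := boolP (fconnect par z' y); first exact: IHp pp lp z'y.
have [zp|z'p] := par_adj z z' zz'.
  by case/negP: z'y; apply: connect_trans zy; rewrite zp fconnect1.
have [ezy|zny] := eqVneq z y.
  rewrite -ezy -z'p z'S /=.
  by apply: contraNneq z'y => ->.
case/negP: z'y; rewrite z'p; move/iter_findex: zy.
case: (findex _ _ _) => [zy|n]; first by rewrite [z]zy eqxx in zny.
by rewrite iterSr => <-; apply: fconnect_iter.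
Qed.

(** Vertices are sorted by the depth of the topmost node [top v] whose bag
    contains them, and [back v] collects the smaller vertices of that bag.
    Edges are covered and back sets are cliques because of one fact ([top_bag]
    below): if [v] and [w] share a bag and [top w] is not deeper than [top v], then the bag of
    [top v] contains [w], because climbing from the shared bag meets [top v]
    before it can leave the subtree of [w]. *)
Lemma treewidth_elimination_order (G : sgraph) t : treewidth_le G t ->
  exists pos back, @elimination_order G t pos back.
Proof.
case=> T [bag [[treeT bagV bagE bagC]] wt].
have [depth [par [par_lt par_adj]]] := tree_root treeT.
have [top topP] : exists top : G -> T, forall v,
    v \in bag (top v) /\ forall x, v \in bag x -> depth (top v) <= depth x.
  apply: (@fin_all_exists _ (fun _ => T) (fun v x =>
    v \in bag x /\ forall y, v \in bag y -> depth x <= depth y)) => v.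
  have [x0 vx0] := bagV v.
  by case: (@arg_minnP _ x0 (fun x => v \in bag x) depth vx0) => x; exists x.
have up v x : v \in bag x -> top v != x ->
    (v \in bag (par x)) && (depth (par x) < depth x).
  move=> vx tvx; have [vt mint] := topP v.
  have := connected_up par_lt par_adj (bagC v) (x := top v) (y := x).
  by rewrite !inE => /(_ vt vx (mint _ vx) tvx) /andP[-> /par_lt].
have top_bag v w : depth (top w) <= depth (top v) ->
    forall n x, depth x <= n -> v \in bag x -> w \in bag x -> w \in bag (top v).
  move=> wv; elim=> [|n IHn] x xn vx wx.
    have [->//|tvx] := eqVneq (top v) x.
    by have /andP[_ /leq_trans/(_ xn)] := up v x vx tvx.
  have [->//|tvx] := eqVneq (top v) x.
  have /andP[vp px] := up v x vx tvx.
  apply: (IHn (par x)) => //; first exact: leq_trans px xn.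
  have [twx|twx] := eqVneq (top w) x; last by have /andP[] := up w x wx twx.
  have := leq_ltn_trans (proj2 (topP v) _ vp) px.
  by rewrite -{1}twx ltnNge wv.
(* Lexicographic: the rank breaks the ties between equal depths. *)
pose pos v := depth (top v) * #|G| + enum_rank v.
have pos_depth v w : pos w < pos v -> depth (top w) <= depth (top v).
  apply: contraTT; rewrite -!leqNgt => vw.
  apply: (@leq_trans ((depth (top v)).+1 * #|G|)).
    by rewrite /pos mulSnr leq_add2l ltnW.
  by apply: leq_trans (leq_addr _ _); rewrite leq_mul2r ltnNge vw orbT.
have pos_inj : injective pos.
  move=> v w /(congr1 (modn^~ #|G|)); rewrite !modnMDl !modn_small //.
  by move/val_inj/enum_rank_inj.
exists pos, (fun v => [set w in bag (top v) | pos w < pos v]); split.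
- exact: pos_inj.
- by move=> v w; rewrite inE => /andP[].
- move=> v; rewrite -ltnS; apply: (@leq_trans #|bag (top v)|).
    apply: proper_card; apply/properP; split.
      by apply/subsetP=> w /setIdP[].
    by exists v; [case: (topP v) | rewrite inE ltnn andbF].
  apply: leq_trans (leqSpred _) _.
  rewrite ltnS; apply: leq_trans wt; rewrite /width -!subn1 leq_sub2r //.
  exact: (leq_bigmax (top v)).
- move=> u v uv; have [x /andP[ux vx]] := bagE u v uv.
  have arc y z : pos y < pos z -> y \in bag x -> z \in bag x ->
      y \in [set w in bag (top z) | pos w < pos z].
    move=> yz yx zx; rewrite inE yz andbT.
    exact: top_bag (pos_depth _ _ yz) _ x (leqnn _) zx yx.
  have [uv'|vu|] := ltngtP (pos u) (pos v).
  + by left; apply: arc.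
  + by right; apply: arc.
  + by move=> uv'; rewrite (pos_inj _ _ uv') adj_irr in uv.
- move=> v w w'; rewrite !inE => /andP[wv _] /andP[w'v _] ww'.
  rewrite ww' andbT.
  exact: top_bag (pos_depth _ _ ww') _ (top v) (leqnn _) w'v wv.
Qed.

(** * Counting the vertices within reach *)

Lemma card_bigcup_le (I T : finType) (J : {set I}) (F : I -> {set T}) n :
  (forall i, i \in J -> #|F i| <= n) -> #|\bigcup_(i in J) F i| <= n * #|J|.
Proof.
move=> Fn; apply: (@leq_trans (\sum_(i in J) #|F i|)); last first.
  by rewrite mulnC -sum_nat_const leq_sum.
elim/big_rec2: _ => [|i m B _ IH]; rewrite ?cards0 //.
by rewrite (leq_trans (leq_card_setU _ _)) ?leq_add2l.
Qed.

Section Elimination.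

Variables (G : sgraph) (t : nat) (pos : G -> nat) (back : G -> {set G}).
Hypothesis elim_order : elimination_order t pos back.

Let pos_back := pos_back elim_order.
Let back_clique := back_clique elim_order.

Lemma pos_cases (P : Prop) v w :
  (pos v < pos w -> P) -> (pos w < pos v -> P) -> (v = w -> P) -> P.
Proof.
move=> lt gt eq; case: (ltngtP (pos v) (pos w)) => // e.
by apply/eq/(pos_inj elim_order).
Qed.

Fixpoint reach k v : {set G} :=
  if k is k'.+1 then v |: \bigcup_(w in back v) reach k' w else [set v].

Definition reach_set k (K : {set G}) := \bigcup_(w in K) reach k w.

Lemma reach_refl k v : v \in reach k v.
Proof. by case: k => [|k] /=; rewrite !inE eqxx. Qed.

Lemma reachSP k v x :
  reflect (x = v \/ exists2 w, w \in back v & x \in reach k w)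
          (x \in reach k.+1 v).
Proof.
rewrite /= in_setU1; apply: (iffP predU1P) => [] [->|H]; try by left.
  by right; have /bigcupP[w wv xw] := H; exists w.
by right; have [w wv xw] := H; apply/bigcupP; exists w.
Qed.

Lemma reachS k v : reach k v \subset reach k.+1 v.
Proof.
elim: k v => [|k IHk] v; apply/subsetP => x.
  by rewrite inE => /eqP->; apply: reach_refl.
case/reachSP=> [->|[w wv xw]]; first exact: reach_refl.
by apply/reachSP; right; exists w => //; apply: (subsetP (IHk w)).
Qed.

(** One step of the induction that bounds [reach k v]: the elements of a clique
    [M] lying above the clique [K] are added in increasing order, and each new
    one, having all earlier ones and [K] among its back neighbours, reaches few
    vertices that they do not reach. The terms sum up by Pascal's rule; the
    binomial coefficient on the left is what remains of the budget on the right
    after [#|M|] additions. *)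
Lemma card_reach_layer k :
  (forall w (K : {set G}), K \subset back w ->
     #|reach k w :\: reach_set k K| <= 'C(k + (t - #|K|), t - #|K|)) ->
  forall v (K M : {set G}), K \subset back v -> M \subset back v ->
  (forall x w, x \in K -> w \in M -> pos x < pos w) ->
  #|reach_set k M :\: reach_set k K|
    + 'C(k.+1 + (t - (#|K| + #|M|)), t - (#|K| + #|M|))
    <= 'C(k.+1 + (t - #|K|), t - #|K|).
Proof.
move=> IHk v K M Kv; have [n] := ubnP #|M|.
elim: n M => // n IHn M Mn Mv KM.
have [->|[w0 w0M]] := set_0Vmem M.
  by rewrite cards0 addn0 /reach_set big_set0 set0D cards0.
case: (@arg_maxnP _ w0 (mem M) pos w0M) => w wM wmax.
have {}wM : w \in M := wM.
pose M' := M :\ w.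
have M'M : M' \subset M by apply: subD1set.
have cM : #|M| = #|M'|.+1 by rewrite (cardsD1 w M) wM.
have IH := IHn M'; rewrite -ltnS -cM in IH.
have {}IH := IH Mn (subset_trans M'M Mv)
  (fun x y xK yM => KM x y xK (subsetP M'M y yM)).
have KM'w : K :|: M' \subset back w.
  apply/subsetP => x; rewrite in_setU => /orP[xK|].
    apply: (@back_clique v); last exact: KM.
      exact: (subsetP Kv).
    exact: (subsetP Mv).
  rewrite in_setD1 => /andP[xw xM].
  apply: (@back_clique v); [exact: (subsetP Mv)|exact: (subsetP Mv)|].
  have xw' : pos x <= pos w by apply: wmax.
  by rewrite ltn_neqAle xw' (inj_eq (pos_inj elim_order)) xw.
have cKM' : #|K :|: M'| = #|K| + #|M'|.
  apply/eqP; rewrite (leq_card_setU K M').2; apply/pred0P => x /=.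
  apply/negP => /andP[xK /(subsetP M'M) xM].
  by have := KM x x xK xM; rewrite ltnn.
have KMt : #|K| + #|M| <= t.
  rewrite cM addnS -cKM'; apply: leq_trans (card_back elim_order v).
  apply: proper_card; apply/properP; split.
    by rewrite subUset Kv (subset_trans M'M).
  exists w; first exact: (subsetP Mv).
  by apply/negP => /(subsetP KM'w)/pos_back; rewrite ltnn.
have new := IHk w _ KM'w; rewrite cKM' in new.
have split_set : reach_set k M :\: reach_set k K \subset
   (reach_set k M' :\: reach_set k K) :|:
   (reach k w :\: reach_set k (K :|: M')).
  apply/subsetP => x; rewrite in_setU !in_setD /reach_set => /andP[xK xM].
  rewrite xK bigcup_setU in_setU negb_or xK /=.
  case: (boolP (x \in \bigcup_(i in M') _)) => //= xM'.
  case/bigcupP: xM => y yM xy; have [<-//|yw] := eqVneq y w.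
  by case/bigcupP: xM'; exists y; rewrite ?in_setD1 ?yw.
have card_split := leq_trans (subset_leq_card split_set) (leq_card_setU _ _).
apply: leq_trans IH.
apply: leq_trans (leq_add card_split (leqnn _)) _.
rewrite -addnA leq_add2l.
apply: leq_trans (leq_add new (leqnn _)) _.
rewrite cM addnS in KMt *.
rewrite -(subnSK KMt); move: (t - _) => d.
by rewrite !addSn binS !addnS.
Qed.

(** The bound for [K = set0] is the one of interest; the induction needs [K] to
    avoid counting twice the vertices reached through several back neighbours.
    A back neighbour of [v] below some [y] in [K] is a back neighbour of [y], so
    what it reaches in [k] steps [y] reaches in [k.+1], and only the back
    neighbours above all of [K] contribute. *)
Lemma card_reach_diff k v (K : {set G}) : K \subset back v ->
  #|reach k v :\: reach_set k K| <= 'C(k + (t - #|K|), t - #|K|).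
Proof.
elim: k v K => [|k IHk] v K Kv.
  by rewrite binn (leq_trans (subset_leq_card (subsetDl _ _))) ?cards1.
pose M := [set w in back v | [forall x in K, pos x < pos w]].
have Mv : M \subset back v by apply/subsetP => w /setIdP[].
have KM x w : x \in K -> w \in M -> pos x < pos w.
  by move=> xK /setIdP[_ /'forall_implyP/(_ x xK)].
have := card_reach_layer IHk Kv Mv KM; apply: leq_trans.
apply: (@leq_trans #|v |: (reach_set k M :\: reach_set k K)|).
  apply/subset_leq_card/subsetP => x; rewrite in_setD => /andP[xK].
  case/reachSP => [->|[w wv xw]]; first by rewrite setU11.
  apply/setU1P; right; rewrite in_setD; apply/andP; split.
    apply: contra xK => /bigcupP[y yK xy]; apply/bigcupP; exists y => //.
    exact: (subsetP (reachS k y)).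
  apply/bigcupP; exists w => //; rewrite inE wv /=.
  apply/'forall_implyP => y yK; have yv := subsetP Kv y yK.
  apply: (@pos_cases _ y w) => // [wy|yw].
    case/negP: xK; apply/bigcupP; exists y => //; apply/reachSP; right.
    by exists w => //; apply: back_clique wv yv wy.
  case/negP: xK; apply/bigcupP; exists y => //.
  by apply: (subsetP (reachS k y)); rewrite yw.
rewrite addnC; apply: leq_trans (leq_card_setU _ _) _.
by rewrite cards1 leq_add2r bin_gt0 leq_addl.
Qed.

Lemma card_reach k v : #|reach k v| <= 'C(k + t, t).
Proof.
have := @card_reach_diff k v set0 (sub0set _).
by rewrite cards0 subn0 /reach_set big_set0 setD0.
Qed.

(** By the clique property, replacing [y] by one of its back neighbours [x] does
    not lengthen the way to a vertex not above [x]. *)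
Lemma reach_back k x y m :
  x \in back y -> m \in reach k y -> pos m <= pos x -> m \in reach k x.
Proof.
elim: k y => [|k IHk] y xy.
  by rewrite inE => /eqP->; rewrite leqNgt pos_back.
case/reachSP => [->|[z zy mz]] mx; first by rewrite leqNgt pos_back in mx.
apply: (@pos_cases _ z x) => [zx|xz|zx].
- by apply/reachSP; right; exists z => //; apply: back_clique zy xy zx.
- apply: (subsetP (reachS k x)); apply: (IHk z) mx => //.
  exact: back_clique xy zy xz.
- by apply: (subsetP (reachS k x)); rewrite -zx.
Qed.

(** * Ancestors and walks *)

(** In a chordal graph a walk to its smallest vertex can be shortcut at each
    local maximum, until it only uses back arcs. *)
Lemma walk_min_reach x p m : path adj x p -> m \in x :: p ->
  (forall z, z \in x :: p -> pos m <= pos z) -> m \in reach (size p) x.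
Proof.
elim: p x m => [|y p IHp] x m; first by rewrite !inE.
move=> /= /andP[xy pp]; have [->|mx] /= := eqVneq m x.
  by move=> *; apply: (reach_refl (size p).+1).
rewrite in_cons (negPf mx) /= => mp mmin.
have my : m \in reach (size p) y.
  by apply: IHp => // z zp; apply: mmin; rewrite in_cons zp orbT.
have [xyb|yxb] := back_adj elim_order xy; last first.
  by apply/reachSP; right; exists y.
apply: (subsetP (reachS _ x)); apply: reach_back my _ => //.
by apply: mmin; rewrite mem_head.
Qed.

Definition ancestor u v := connect [rel x y | y \in back x] u v.

Lemma ancestor_pos u v : ancestor u v -> pos v <= pos u.
Proof.
case/connectP => p pp ->; elim: p u pp => //= w p IHp u /andP[wu pp].
exact: leq_trans (IHp w pp) (ltnW (pos_back wu)).
Qed.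

Lemma reach_ancestor k u v : v \in reach k u -> ancestor u v.
Proof.
elim: k u => [|k IHk] u; first by rewrite inE => /eqP->; apply: connect0.
case/reachSP => [->|[w wu vw]]; first exact: connect0.
exact: connect_trans (connect1 wu) (IHk w vw).
Qed.

Lemma ancestorE u v : ancestor u v ->
  u = v \/ exists2 w, w \in back u & ancestor w v.
Proof.
case/connectP=> [[|w p] /= pp ->]; [by left | right].
by case/andP: pp => wu pp; exists w => //; apply/connectP; exists p.
Qed.

Lemma ancestor_reach u v : ancestor u v -> exists k, v \in reach k u.
Proof.
case/connectP => p pp ->; exists (size p).
elim: p u pp => [|w p IHp] u /=; first by rewrite inE.
by case/andP=> wu pp; apply/reachSP; right; exists w => //; apply: IHp.
Qed.

Lemma ancestor_chain u x y : ancestor u x -> ancestor u y ->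
  pos x <= pos y -> ancestor y x.
Proof.
move=> + /connectP[p]; elim: p u => [|z p IHp] u ux /=; first by move=> _ ->.
case/andP=> zu pp ly xy; apply: (IHp z) => //.
have /ancestor_reach[k xk] := ux; apply: (@reach_ancestor k).
apply: reach_back zu xk _; apply: leq_trans xy _.
by apply: ancestor_pos; apply/connectP; exists p.
Qed.

(** The vertices that have [v] as an ancestor form a subtree below [v], and all
    edges out of it end in [back v]: if the last vertex [x] is a back neighbour
    of [y], it remains one of each vertex on the way from [y] to [v], since it
    lies below all of them. *)
Lemma leave_subtree v y x : ancestor y v -> adj y x -> ~~ ancestor x v ->
  x \in back v.
Proof.
move=> yv yx nxv; have [yx'|xy] := back_adj elim_order yx.
  by case/negP: nxv; apply: connect_trans yv; apply: connect1.
have xv : pos x < pos v.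
  rewrite ltnNge; apply: contra nxv => vx.
  by apply: ancestor_chain yv _ vx; apply: connect1.
have /connectP[p pp lp] := yv; elim: p {yx yv} y xy pp lp => [|z p IHp] y xy /=.
  by move=> _ ->.
case/andP=> zy pp lp; apply: (IHp z) => //.
apply: back_clique xy zy _; apply: leq_trans xv _.
by apply: ancestor_pos; apply/connectP; exists p.
Qed.

Lemma cross_back u p v m : path adj u p -> ancestor u v ->
  m \in u :: p -> pos m < pos v -> exists2 s, s \in back v & s \in u :: p.
Proof.
elim: p u => [|x p IHp] u /=.
  by move=> _ uv; rewrite inE => /eqP->; rewrite ltnNge ancestor_pos.
case/andP=> ux pp uv; rewrite in_cons => /predU1P[->|mp] mv.
  by rewrite ltnNge ancestor_pos in mv.
have [xv|nxv] := boolP (ancestor x v).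
  by have [s sv sp] := IHp x pp xv mp mv; exists s; rewrite // in_cons sp orbT.
by exists x; [apply: leave_subtree uv ux nxv | rewrite !inE eqxx orbT].
Qed.

(** The smallest vertex of a walk is reached by back arcs from both of its
    ends; the second end is handled by reversing the walk. *)
Lemma walk_min u p : path adj u p -> exists m,
  [/\ m \in u :: p, ancestor u m & m \in reach (size p) (last u p)].
Proof.
move=> pp.
case: (@arg_minnP _ u (mem (u :: p)) pos (mem_head _ _)) => m mp mmin.
exists m; split=> //.
  exact: reach_ancestor (walk_min_reach pp mp mmin).
have rev_mem z : (z \in last u p :: rev (belast u p)) = (z \in u :: p).
  by rewrite (lastI u p) mem_rcons !in_cons mem_rev.
have -> : size p = size (rev (belast u p)) by rewrite size_rev size_belast.
apply: walk_min_reach => [||z]; rewrite ?rev_mem //; last exact: mmin.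
by rewrite rev_path (eq_path (e' := adj)) // => x y; rewrite /= adj_sym.
Qed.

Lemma reach_leq k l v : k <= l -> reach k v \subset reach l v.
Proof.
move/subnKC <-; elim: (l - k) => [|n IHn]; rewrite ?addn0 //.
by rewrite addnS (subset_trans IHn) ?reachS.
Qed.

(** * Counting profiles *)

Section Profiles.

Variables (A : {set G}) (r : nat).

Definition hubs : {set G} := reach_set r A.

(** For [v] in [hubs], the vertices whose largest hub ancestor is [v]. *)
Definition hub_class v : {set G} :=
  [set u | ancestor u v &
    [forall m in hubs, ancestor u m ==> (pos m <= pos v)]].

Lemma card_hubs : #|hubs| <= 'C(r + t, t) * #|A|.
Proof. by apply: card_bigcup_le => a _; apply: card_reach. Qed.

Lemma short_walk_hub u p : path adj u p -> last u p \in A -> size p <= r ->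
  exists m, [/\ m \in u :: p, ancestor u m & m \in hubs].
Proof.
move=> pp lA pr; have [m [mp um ml]] := walk_min pp; exists m; split=> //.
by apply/bigcupP; exists (last u p) => //; apply: (subsetP (reach_leq _ pr)).
Qed.

(** The guard is [back w], where [w] is the smallest ancestor of [u] above [v].
    A short walk passes through a hub ancestor of [u], which lies at or below
    [v], hence below [w], so the walk crosses [back w]. As the ancestors of [u]
    form a chain with no member strictly between [v] and [w], the vertex [v] is
    the largest element of [back w], and the others are back neighbours of
    [v]. *)
Lemma hub_guard u v : u \in hub_class v -> u != v ->
  exists S : {set G},
    [/\ v \in S, S \subset v |: back v, #|S| <= t & guards r A S u].
Proof.
rewrite inE => /andP[uv /'forall_implyP hub_le] neq.
have vu : pos v < pos u.
  rewrite ltn_neqAle ancestor_pos // andbT.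
  by apply: contra neq => /eqP/(pos_inj elim_order)->.
have u0 : ancestor u u && (pos v < pos u) by rewrite vu /ancestor connect0.
case: (@arg_minnP _ u (fun w => ancestor u w && (pos v < pos w)) pos u0).
move=> w /andP[uw vw] wmin.
have back_w z : z \in back w -> pos z <= pos v.
  move=> zw; rewrite leqNgt; apply/negP=> vz.
  have /wmin : ancestor u z && (pos v < pos z).
    by rewrite vz andbT; apply: connect_trans uw _; apply: connect1.
  by rewrite leqNgt pos_back.
have vw_back : v \in back w.
  have [wv|[z zw zv]] := ancestorE (ancestor_chain uv uw (ltnW vw)).
    by rewrite wv ltnn in vw.
  suff <- : z = v by [].
  by apply/(pos_inj elim_order)/eqP; rewrite eqn_leq back_w // ancestor_pos.
exists (back w); split=> //; last 1 first.
- move=> p pp lA pr; have [m [mp um mW]] := short_walk_hub pp lA pr.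
  apply: cross_back pp uw mp _; apply: leq_ltn_trans vw.
  exact: (implyP (hub_le m mW)).
- apply/subsetP => x xw; rewrite in_setU1.
  have [//|xv /=] := eqVneq x v; apply: (back_clique xw vw_back).
  rewrite ltn_neqAle (back_w x xw) andbT.
  by apply: contra xv => /eqP/(pos_inj elim_order)->.
- exact: card_back elim_order w.
Qed.

(** If [back v] has fewer than [t] elements then [v |: back v] is a guard of
    size at most [t] for the whole class. Otherwise every guard from
    [hub_guard] misses an element of [v |: back v], which is not [v]; this
    leaves [t] guards of size [t], and the profile of [v] itself. *)
Lemma card_hub_class_profiles v :
  #|profile r A @: hub_class v| <= (t + 1) * (r + 2) ^ t.
Proof.
have vNback : v \notin back v by apply/negP => /pos_back; rewrite ltnn.
have guard_sub (S S' : {set G}) u :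
    S \subset S' -> guards r A S u -> guards r A S' u.
  move=> SS' gu p pp lA pr; have [s sS sp] := gu p pp lA pr.
  by exists s => //; apply: (subsetP SS').
have r2 : 0 < (r + 2) by rewrite addn2.
have [back_small|back_full] := ltnP #|back v| t.
  apply: (@leq_trans ((r + 2) ^ #|v |: back v|)).
    apply: card_guarded_profiles => u uv; have [->|neq] := eqVneq u v.
      by move=> p _ _ _; exists v; rewrite ?setU11 ?mem_head.
    by have [S [_ SK _ gS]] := hub_guard uv neq; apply: guard_sub gS.
  apply: (@leq_trans ((r + 2) ^ t)).
    by rewrite leq_pexp2l // cardsU1 vNback.
  by rewrite leq_pmull // addn1.
(* [f u] is a vertex missed by the guard of [u]. *)
have [f fP] : exists f : G -> G, forall u, u \in hub_class v -> u != v ->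
    f u \in back v /\ guards r A ((v |: back v) :\ f u) u.
  suff ex u : exists s, u \in hub_class v -> u != v ->
      s \in back v /\ guards r A ((v |: back v) :\ s) u.
    exact: fin_all_exists ex.
  have [uv|] := boolP (u \in hub_class v); last by exists v.
  have [->|neq] := eqVneq u v; first by exists v.
  have [S [vS SK St gS]] := hub_guard uv neq.
  have /subsetPn[s sK sS] : ~~ (v |: back v \subset S).
    apply/negP => /subset_leq_card; rewrite cardsU1 vNback leqNgt add1n ltnS.
    by rewrite (leq_trans St).
  have sv : s != v by apply: contraNneq sS => ->.
  rewrite in_setU1 (negPf sv) in sK; exists s => _ _; split=> //.
  by apply: guard_sub gS; rewrite subsetD1 SK.
pose part s := [set u in hub_class v | (u != v) && (f u == s)].
have cover : profile r A @: hub_class v \subset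
    profile r A v |: \bigcup_(s in back v) profile r A @: part s.
  apply/subsetP => _ /imsetP[u uv ->]; have [->|neq] := eqVneq u v.
    by rewrite setU11.
  have [fv _] := fP u uv neq; apply/setU1P; right.
  by apply/bigcupP; exists (f u) => //; apply: imset_f; rewrite inE uv neq /=.
apply: leq_trans (subset_leq_card cover) _.
apply: leq_trans (leq_card_setU _ _) _; rewrite cards1 addnC mulnDl mul1n.
apply: leq_add; last by rewrite expn_gt0 r2.
rewrite mulnC; apply: (@leq_trans ((r + 2) ^ t * #|back v|)); last first.
  by rewrite leq_mul2l (card_back elim_order) orbT.
apply: card_bigcup_le => s sv.
have card_guard : #|(v |: back v) :\ s| = #|back v|.
  have := cardsD1 s (v |: back v).
  by rewrite in_setU1 sv orbT cardsU1 vNback /= => /eqP; rewrite eqSS => /eqP.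
have part_guarded u : u \in part s -> guards r A ((v |: back v) :\ s) u.
  by case/setIdP=> uv /andP[neq /eqP<-]; case: (fP u uv neq).
apply: leq_trans (card_guarded_profiles part_guarded) _.
by rewrite card_guard leq_pexp2l // (card_back elim_order).
Qed.

Lemma card_profiles : #|profiles r [set: G] A|
   <= (t + 1) * (r + 2) ^ t * 'C(r + t, t) * #|A|.
Proof.
rewrite -mulnA; apply: leq_trans (leq_mul (leqnn _) card_hubs).
apply: (leq_trans _ (card_bigcup_le (fun v _ => card_hub_class_profiles v))).
apply/subset_leq_card/subsetP => f; rewrite in_setD1.
case/andP=> + /imsetP[u _ fu]; rewrite fu => /profile_neq_infty[a aA].
case=> p [pp lp pr]; have [|m0 [_ um0 mW0]] := short_walk_hub pp _ pr.
  by rewrite lp.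
have m0P : (m0 \in hubs) && ancestor u m0 by rewrite mW0.
case: (@arg_maxnP _ m0 (fun m => (m \in hubs) && ancestor u m) pos m0P).
move=> v /andP[vW uv] vmax; apply/bigcupP; exists v => //.
apply: imset_f; rewrite inE uv; apply/'forall_implyP => m mW.
by apply/implyP => um; apply: vmax; rewrite mW.
Qed.

End Profiles.

End Elimination.

Lemma profile_bound_polynomial t r : 0 < r ->
  (t + 1) * (r + 2) ^ t * 'C(r + t, t)
    <= (t + 1) * 3 ^ t * (t + 1) ^ t * r ^ (2 * t).
Proof.
move=> r0; have r2 : r + 2 <= 3 * r.
  by rewrite mulSn leq_add2l leq_pmulr.
have expW m n : m <= n -> m ^ t <= n ^ t.
  by case: (t) => // k mn; rewrite leq_exp2r.
have bin_le : 'C(r + t, t) <= ((t + 1) * r) ^ t.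
  apply: (@leq_trans ((r + t) ^ t)).
    apply: (@leq_trans ((r + t) ^_ t)).
      by rewrite -bin_ffact leq_pmulr ?fact_gt0.
    by elim: {2 4}t => // n IHn; rewrite ffactnSr expnSr leq_mul // leq_subr.
  by apply: expW; rewrite mulnDl mul1n addnC leq_add2r leq_pmulr.
apply: leq_trans (leq_mul (leq_mul (leqnn _) (_ : _ <= (3 * r) ^ t)) bin_le) _.
  exact: expW.
rewrite !expnMn mul2n -addnn expnD !mulnA leq_eqVlt; apply/orP; left.
by apply/eqP; congr (_ * _); rewrite -!mulnA; do 2 congr (_ * _); rewrite mulnC.
Qed.

Theorem corollary18 (t : nat) :
  (forall G : sgraph, treewidth_le G t ->
     forall (A : {set G}) (r : nat),
       #|profiles r [set: G] A|
         <= (t + 1) * (r + 2) ^ t * 'C(r + t, t) * #|A|)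
  /\
  (exists C : nat, forall G : sgraph, treewidth_le G t ->
     forall (A : {set G}) (r : nat), 1 <= r ->
       #|profiles r [set: G] A| <= C * r ^ (2 * t) * #|A|).
Proof.
have bound (G : sgraph) : treewidth_le G t -> forall (A : {set G}) r,
    #|profiles r [set: G] A| <= (t + 1) * (r + 2) ^ t * 'C(r + t, t) * #|A|.
  case/treewidth_elimination_order=> pos [back elim_order] A r.
  exact: card_profiles elim_order A r.
split=> //; exists ((t + 1) * 3 ^ t * (t + 1) ^ t) => G tw A r r0.
apply: leq_trans (bound G tw A r) _.
by rewrite leq_mul2r profile_bound_polynomial ?orbT.
Qed.
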